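(* Let $N$ be even and let $g=g_{1,N}\in\mathbb{G}[x_1,\ldots,x_N]$ be the Raz–Yehudayoff polynomial described in the context. Let $\alpha>1/10$ and let $f_1,\ldots,f_m$ be polynomials computed by $\alpha$-sparse ROABPs of size $s<2^{N^{9/40}/\log N}$ such that $g=f_1+\cdots+f_m$. Then $m\ge 2^{N^{1/11}}$.
   Context: Let $\mathbb{F}$ be a field, $X=\{x_1,\ldots,x_N\}$ with $N$ even, $\mathcal{W}=\{w_{i,k,j}\}_{i,k,j\in[N]}$ further variables and $\mathbb{G}=\mathbb{F}(\mathcal{W})$. For an interval $[i,j]$ of even length define $g_{i,j}\in\mathbb{G}[X]$ by $g_{i,j}=1$ if $|[i,j]|=0$, and otherwise $g_{i,j}=(1+x_ix_j)g_{i+1,j-1}+\sum_k w_{i,k,j}g_{i,k}g_{k+1,j}$, the sum over $k\in[i+1,j-2]$ with $|[i,k]|$ even; $g=g_{1,N}$. An ABP is a layered DAG with start node $s$ and terminal node $t$ whose edges carry labels (here polynomials), computing the sum over $s$-$t$ paths of the product of labels; size = number of nodes. An $\alpha$-sparse ROABP is an ABP with $d+1$ layers $L_0,\ldots,L_d$ for which there is a partition of $X$ into $d=\Theta(N^\alpha)$ sets $X_1,\ldots,X_d$ with $|X_i|=N/d$ such that every edge label leaving layer $L_i$ is a $t$-sparse multilinear polynomial in $\mathbb{F}[X_i]$ (at most $t$ monomials with nonzero coefficient), with $t=N^{O(1)}$.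
   Formalization: The bound is proved for all sufficiently large even N, with the threshold depending on α and the constants in d=Θ(N^α) and t=N^{O(1)}; for N=2 it fails, since g=1+x_1x_2 is a single program of size 2. Edge labels may have coefficients in G, and log is base 2. *)

(* Defs.v *)
From HB Require Import structures.
From mathcomp Require Import all_boot all_order all_algebra.
From mathcomp Require Import reals exp.
From mathcomp Require Import mpoly.
From mathcomp Require Import zify.

Set Implicit Arguments.
Unset Strict Implicit.
Unset Printing Implicit Defensive.

Import GRing.Theory.

Local Open Scope ring_scope.

Section RazYehudayoff.

Variables (F : fieldType) (N : nat).

Definition Windex : finType := ('I_N * 'I_N * 'I_N)%type.

(* The field of rational functions F(W), one variable per triple (i, k, j). *)
Definition ratW : fieldType := {fraction {mpoly F[#|Windex|]}}.

(* Indices are the 1-based naturals 1, ..., N; the variable of index i is the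
   one numbered i - 1 in 'I_N. The value 0 at out-of-range indices is junk and
   is never reached from the interval [1, N]. *)
Definition ord_of_index (i : nat) : option 'I_N :=
  if i is i'.+1 then insub i' else None.

Definition xvar (i : nat) : {mpoly ratW[N]} :=
  if ord_of_index i is Some o then 'X_o else 0.

Definition wvar (i k j : nat) : ratW :=
  if (ord_of_index i, ord_of_index k, ord_of_index j)
    is (Some a, Some b, Some c)
  then tofrac ('X_(enum_rank ((a, b, c) : Windex)) : {mpoly F[#|Windex|]})
  else 0.

Definition itv_len (i j : nat) : nat := (j.+1 - i)%N.

(* Recursion on a bound [n] for the length of the interval [i, j]. *)
Fixpoint ry_rec (n i j : nat) : {mpoly ratW[N]} :=
  if n is n'.+1 then
    if itv_len i j == 0%N then 1
    else (1 + xvar i * xvar j) * ry_rec n' i.+1 j.-1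
         + \sum_(i.+1 <= k < j.-1 | ~~ odd (itv_len i k))
             wvar i k j *: (ry_rec n' i k * ry_rec n' k.+1 j)
  else 1.

Definition ry_itv (i j : nat) : {mpoly ratW[N]} := ry_rec (itv_len i j) i j.

Definition ry_poly : {mpoly ratW[N]} := ry_itv 1 N.

Lemma ry_rec_bound n1 n2 i j :
  (itv_len i j <= n1)%N -> (itv_len i j <= n2)%N ->
  ry_rec n1 i j = ry_rec n2 i j.
Proof.
rewrite /itv_len; elim: n1 n2 i j => [|n1 IH] [|n2] i j //= le1 le2.
- by rewrite ifT // /itv_len; lia.
- by rewrite ifT // /itv_len; lia.
- case: ifP => [//|/negbT nz]; rewrite /itv_len in nz.
  congr (_ * _ + _); first by apply: IH; lia.
  rewrite big_nat_cond [RHS]big_nat_cond; apply: eq_bigr => k /andP[hk _].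
  by congr (_ *: (_ * _)); apply: IH; lia.
Qed.

(* The defining recurrence, for nonempty [i, j]; the index [k]
   ranges over [i + 1, j - 2]. *)
Lemma ry_itvE i j : (i <= j)%N ->
  ry_itv i j =
    (1 + xvar i * xvar j) * ry_itv i.+1 j.-1
    + \sum_(i.+1 <= k < j.-1 | ~~ odd (itv_len i k))
        wvar i k j *: (ry_itv i k * ry_itv k.+1 j).
Proof.
move=> le_ij; rewrite {1}/ry_itv.
have -> : itv_len i j = (j - i).+1 by rewrite /itv_len; lia.
rewrite [LHS]/= ifF; last by rewrite /itv_len; lia.
congr (_ * _ + _); first by apply: ry_rec_bound; rewrite /itv_len; lia.
rewrite big_nat_cond [RHS]big_nat_cond; apply: eq_bigr => k /andP[hk _].
by congr (_ *: (_ * _)); apply: ry_rec_bound; rewrite /itv_len; lia.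
Qed.

Lemma ry_itv0 i j : itv_len i j = 0%N -> ry_itv i j = 1.
Proof. by rewrite /ry_itv => ->. Qed.

End RazYehudayoff.

(* A layered digraph with layers 0, ..., d; edges go from one layer to the
   next. The value of [abp_label] off the edges is irrelevant. *)
Record abp (A : Type) (d : nat) := Abp {
  abp_node : finType;
  abp_layer : abp_node -> 'I_d.+1;
  abp_edge : rel abp_node;
  abp_label : abp_node -> abp_node -> A;
  abp_src : abp_node;
  abp_snk : abp_node;
  abp_src_layer : abp_layer abp_src = 0%N :> nat;
  abp_snk_layer : abp_layer abp_snk = d :> nat;
  abp_edge_layer : forall u v, abp_edge u v ->
    abp_layer v = (abp_layer u).+1 :> nat
}.

Definition abp_size (A : Type) (d : nat) (P : abp A d) : nat :=
  #|abp_node P|.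

(* The layers force every source-to-sink path to have exactly [d] edges, so
   summing over [d]-tuples of successors of the source loses no path. *)
Definition abp_eval (A : pzSemiRingType) (d : nat) (P : abp A d) : A :=
  \sum_(p : d.-tuple (abp_node P) |
           path (@abp_edge _ _ P) (abp_src P) p
           && (last (abp_src P) p == abp_snk P))
     \prod_(a <- pairmap (@abp_label _ _ P) (abp_src P) p) a.

Section SparseROABP.

Variables (K : fieldType) (N : nat).

Definition multilinear (p : {mpoly K[N]}) : Prop :=
  forall m, m \in msupp p -> forall i, (m i <= 1)%N.

Definition sparse (t : nat) (p : {mpoly K[N]}) : Prop :=
  (size (msupp p) <= t)%N.

Definition in_vars (X : {set 'I_N}) (p : {mpoly K[N]}) : Prop :=
  forall m, m \in msupp p -> forall i, m i != 0%N -> i \in X.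

Definition equipartition (d : nat) (X : 'I_d -> {set 'I_N}) : Prop :=
  [/\ forall i j, i != j -> [disjoint X i & X j],
      \bigcup_i X i = [set: 'I_N]
    & forall i, (#|X i| * d = N)%N].

(* With 0-based blocks, the edges leaving layer [i] read the block [X i]. *)
Definition sparse_roabp (t d : nat) (P : abp {mpoly K[N]} d) : Prop :=
  exists X : 'I_d -> {set 'I_N}, equipartition X /\
    forall (i : 'I_d) (u v : abp_node P),
      abp_edge u v -> abp_layer u = i :> nat ->
      [/\ in_vars (X i) (abp_label u v), multilinear (abp_label u v)
        & sparse t (abp_label u v)].

(* [c1] and [c2] are the constants of d = Theta(N^alpha), and [C] is the
   exponent of t = N^O(1). *)
Definition alpha_sparse_roabp (R : realType) (alpha c1 c2 : R) (C d : nat)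
    (P : abp {mpoly K[N]} d) : Prop :=
  [/\ (c1 * N%:R `^ alpha <= d%:R)%R,
      (d%:R <= c2 * N%:R `^ alpha)%R
    & exists2 t : nat, (t <= N ^ C)%N & sparse_roabp t P].

End SparseROABP.

Definition log2 (R : realType) (x : R) : R := ln x / ln 2.

(* Main.v *)
(* A program reading the blocks in some order can be cut at any layer, which
   writes its polynomial as a sum of at most s products A_u * B_u, with A_u in the
   variables P read before the cut and B_u in the others. For a set S of half of
   the variables, the coefficient matrix of such a sum, with rows indexed by the
   monomials in S and columns by the monomials outside S, has rank at most
   s * 2^(N/2 - b), where b is the imbalance between S and its complement on P.
   For a random S, the random walk of imbalances over about N^(1/10) equally
   spaced cuts stays small only if every chunk between consecutive cuts is nearly
   even, which has probability at most 1/2 for each chunk. As a balanced S is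
   only polynomially rare, a union bound over fewer than 2^(N^(1/11)) programs
   gives a balanced S for which every program has small rank.

   On the other hand the matrix of g is nonsingular for every balanced S:
   specialising the weights to suitable powers of one indeterminate makes the
   product of 1 + x_i x_p(i), over the pairs of a noncrossing matching p of S with
   its complement, the leading term of g. *)

Require Import Defs.
From HB Require Import structures.
From mathcomp Require Import all_boot all_order all_algebra.
From mathcomp Require Import reals exp.
From mathcomp Require Import mpoly.
From mathcomp Require Import perm zify lra.

Set Implicit Arguments.
Unset Strict Implicit.
Unset Printing Implicit Defensive.

Import Order.TTheory GRing.Theory Num.Theory.

(** * Counting nearly even sets *)

(** Consecutive binomials increase up to the middle; the upper half follows by symmetry. *)
Lemma bin_le_half n j : 'C(n, j) <= 'C(n, n./2).
Proof.
have mono i : i.+1 <= n./2 -> 'C(n, i) <= 'C(n, i.+1).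
  move=> le_i; rewrite -(leq_pmul2l (ltn0Sn i)) mul_bin_left leq_mul2r.
  by apply/orP; right; lia.
have low i : i <= n./2 -> 'C(n, i) <= 'C(n, n./2).
  move=> le_i; rewrite -(subKn le_i).
  elim: (n./2 - i) (leq_subr i n./2) => [|e IH] le_e; first by rewrite subn0.
  apply: leq_trans (IH (ltnW le_e)).
  have -> : n./2 - e = (n./2 - e.+1).+1 by lia.
  by apply: mono; lia.
case: (leqP j n./2) => [/low//|lt_j].
case: (leqP j n) => [le_jn|lt_nj]; last by rewrite bin_small.
by rewrite -(bin_sub le_jn); apply: low; lia.
Qed.

(** Since $(p+1)\binom{2p+2}{p+1} = 2(2p+1)\binom{2p}{p}$, the induction step reduces to
    $(2p+1)(2p+3) \le (2p+2)^2$. *)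
Lemma central_bin_sqr p : 'C(p.*2, p) ^ 2 * p.*2.+1 <= 16 ^ p.
Proof.
elim: p => [//|p IH].
have E1 := mul_bin_diag p.*2.+2 p; have E2 := mul_bin_down p.*2.+1 p.
rewrite doubleS; rewrite /= in E1 E2.
have E3 : p.+1 * 'C(p.*2.+2, p.+1) = 2 * p.*2.+1 * 'C(p.*2, p).
  have e : p.*2.+1 - p = p.+1 by lia.
  by rewrite e in E2; nia.
have p2 : 0 < p.+1 ^ 2 by rewrite expn_gt0.
rewrite -(leq_pmul2l p2) mulnA -expnMn E3 expnMn (expnS 16).
rewrite !expnMn in IH *.
move: ('C(_, _) ^ 2) (16 ^ p) IH => c s IH.
have -> : 2 ^ 2 * p.*2.+1 ^ 2 * c * p.*2.+3
   = (4 * p.*2.+1 * p.*2.+3) * (c * p.*2.+1) by rewrite -!mulnn; lia.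
apply: (@leq_trans ((4 * p.*2.+1 * p.*2.+3) * s)).
  by rewrite leq_mul2l IH orbT.
by rewrite mulnA leq_mul2r -!mulnn; apply/orP; right; lia.
Qed.

(** The bound $\binom{n}{j} \le 2^n/\sqrt{n}$ without roots: no single size is likely for a random
    set. *)
Lemma bin_sqr_bound n j : 'C(n, j) ^ 2 * n <= 4 ^ n.
Proof.
apply: (@leq_trans ('C(n, n./2) ^ 2 * n)).
  by rewrite leq_mul2r leq_sqr bin_le_half orbT.
have E4 p : 4 ^ p.*2 = 16 ^ p by rewrite -mul2n expnM.
have := odd_double_half n; set p := n./2; clearbody p => <-.
case: (odd n); last first.
  rewrite add0n E4; apply: leq_trans (central_bin_sqr _).
  by rewrite leq_mul2l leqnSn orbT.
have le2 : 'C(1 + p.*2, p) <= 2 * 'C(p.*2, p).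
  rewrite add1n; case: p => [|p]; first by rewrite !bin0.
  rewrite binS mulSn mul1n leq_add2l.
  by have := bin_le_half p.+1.*2 p; rewrite doubleK.
apply: (@leq_trans ((2 * 'C(p.*2, p)) ^ 2 * (1 + p.*2))).
  by rewrite leq_mul2r leq_sqr le2 orbT.
by rewrite expnMn expnD E4 -mulnA leq_mul2l /= add1n central_bin_sqr.
Qed.

Lemma pow2_le_central_bin n : 2 ^ n <= n.+1 * 'C(n, n./2).
Proof.
rewrite -[2]/(1 + 1) expnDn.
apply: (@leq_trans (\sum_(i < n.+1) 'C(n, n./2))).
  by apply: leq_sum => i _; rewrite !exp1n !muln1 bin_le_half.
by rewrite sum_nat_const card_ord.
Qed.

Section Counting.
Variable T : finType.
Implicit Types (C S P : {set T}) (Q A : pred {set T}).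

(** Independence for a uniformly random [S]: [Q] depends only on the part of [S] outside [C], and
    [A] is tested on the part inside. *)
Lemma card_splitI C Q A : (forall S, Q S = Q (S :\: C)) ->
  #|[set S : {set T} | Q S && A (S :&: C)]| =
  #|[set S : {set T} | (S \subset ~: C) && Q S]| * #|[set S : {set T} | (S \subset C) && A S]|.
Proof.
move=> QE; rewrite -cardsX.
have inj : injective (fun S => (S :\: C, S :&: C)).
  by move=> S1 S2 [E1 E2]; rewrite -(setID S1 C) E1 E2 setID.
rewrite -(card_imset _ inj); apply: eq_card => -[S1 S2]; rewrite !inE /=.
apply/imsetP/andP => [[S] |[/andP[s1 q1] /andP[s2 a2]]].
  rewrite inE => /andP[qS aS] [-> ->]; rewrite -QE qS aS subsetIr !andbT.
  by split => //; apply/subsetP => x; rewrite !inE => /andP[].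
have n1 x : x \in S1 -> x \in C = false.
  by move/(subsetP s1); rewrite inE => /negbTE.
have E1 : (S1 :|: S2) :\: C = S1.
  apply/setP => x; rewrite !inE; have := n1 x; have := subsetP s2 x.
  by case: (x \in S1) => [_ ->//|i2 _]; case: (x \in S2) i2 => [->|_] //=; rewrite andbF.
have E2 : (S1 :|: S2) :&: C = S2.
  apply/setP => x; rewrite !inE; have := n1 x; have := subsetP s2 x.
  case: (x \in S2) => [-> //|_]; first by rewrite orbT.
  by case: (x \in S1) => [->|].
exists (S1 :|: S2); last by rewrite E1 E2.
by rewrite inE QE E1 E2 q1.
Qed.

Lemma card_splitI_half C Q A : (forall S, Q S = Q (S :\: C)) ->
  #|[set S : {set T} | (S \subset C) && A S]| * 2 <= 2 ^ #|C| ->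
  #|[set S : {set T} | Q S && A (S :&: C)]| * 2 <= #|[set S : {set T} | Q S]|.
Proof.
move=> QE hA; have := card_splitI predT QE.
have -> : [set S : {set T} | Q S && predT (S :&: C)] = [set S : {set T} | Q S].
  by apply/setP => S; rewrite !inE andbT.
have -> : [set S : {set T} | (S \subset C) && predT S] = powerset C.
  by apply/setP => S; rewrite !inE andbT.
by rewrite card_powerset card_splitI // => ->; rewrite -mulnA leq_mul2l hA orbT.
Qed.

(* The two conditions say that [S] and its complement split [P] evenly, up to
   an imbalance smaller than [b]. *)
Definition nearly_even b S P :=
  (2 * #|S :&: P| < #|P| + b) && (#|P| < 2 * #|S :&: P| + b).

(** Near evenness confines [#|S|] to a window of [4 * k] sizes. As [64 * k ^ 2 <= #|C|], each size
    accounts for at most a fraction $1/(8k)$ of the subsets of [C]. *)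
Lemma card_nearly_even_half k C : 0 < k -> 64 * k ^ 2 <= #|C| ->
  #|[set S : {set T} | (S \subset C) && nearly_even (4 * k).-1 S C]| * 2
    <= 2 ^ #|C|.
Proof.
move=> k0 leC; set n := #|C|; pose lo := (n - (4 * k - 2))./2.
pose D (i : 'I_(4 * k)) := [set S : {set T} | S \subset C & #|S| == lo + i].
have cD i : 8 * k * #|D i| <= 2 ^ n.
  rewrite /D cards_draws -leq_sqr.
  apply: (@leq_trans ('C(n, lo + i) ^ 2 * n)).
    by rewrite expnMn mulnC leq_mul2l expnMn leC orbT.
  by rewrite -expnM (mulnC n 2) (expnM 2 2) bin_sqr_bound.
set X := [set S : {set T} | _].
have le1 : #|X| <= \sum_i #|D i|.
  apply: (@leq_trans #|\bigcup_i D i|).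
    apply/subset_leq_card/subsetP => S; rewrite !inE => /andP[sSC].
    rewrite /nearly_even (setIidPl sSC) -/n => /andP[h1 h2].
    have lt : #|S| - lo < 4 * k by rewrite /lo; lia.
    apply/bigcupP; exists (Ordinal lt) => //.
    by rewrite inE sSC /= subnKC // /lo; lia.
  elim/big_rec2: _ => [|i x y _ le]; first by rewrite cards0.
  by apply: leq_trans (leq_card_setU _ _) _; rewrite leq_add2l.
have le2 : 8 * k * #|X| <= 4 * k * 2 ^ n.
  apply: (@leq_trans (8 * k * \sum_i #|D i|)); first by rewrite leq_mul2l le1 orbT.
  rewrite big_distrr /=.
  apply: (@leq_trans (\sum_(i < 4 * k) 2 ^ n)); first by apply: leq_sum.
  by rewrite sum_nat_const card_ord.
have k4 : 0 < 4 * k by lia.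
by rewrite -(leq_pmul2l k4); lia.
Qed.

(** The increments of the chain are disjoint, so the traces of a random [S] on them are independent.
    Each trace has to be nearly even, which costs a factor 2 per increment. *)
Lemma card_nearly_even_chain k r (P : nat -> {set T}) :
  0 < k -> P 0 = set0 ->
  (forall a, a < r -> P a \subset P a.+1) ->
  (forall a, a < r -> 64 * k ^ 2 <= #|P a.+1 :\: P a|) ->
  #|[set S : {set T} | all (fun a => nearly_even (2 * k) S (P a)) (iota 0 r.+1)]| * 2 ^ r
    <= 2 ^ #|T|.
Proof.
move=> k0 P0; elim: r => [|r IH] sub big.
  by rewrite muln1 -cardsT -card_powerset powersetT; apply/subset_leq_card/subsetT.
have sub' a : a <= r -> P a \subset P r.
  move=> le_ar; rewrite -(subKn le_ar).
  elim: (r - a) (leq_subr a r) => [|e IHe] le_e; first by rewrite subn0.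
  apply: subset_trans (IHe (ltnW le_e)).
  have -> : r - e = (r - e.+1).+1 by lia.
  by apply: sub; lia.
set C := P r.+1 :\: P r.
(* [Q] looks only at [P 0], ..., [P r], all disjoint from the last increment [C]. *)
pose Q S := all (fun a => nearly_even (2 * k) S (P a)) (iota 0 r.+1).
have QE S : Q S = Q (S :\: C).
  apply: eq_in_all => a; rewrite mem_iota add0n => /andP[_ le_ar].
  rewrite /nearly_even; suff -> : (S :\: C) :&: P a = S :&: P a by [].
  apply/setP => x; rewrite !inE; case xa: (x \in P a); rewrite ?andbF //.
  by rewrite (subsetP (sub' _ le_ar)).
have h := card_splitI_half QE (card_nearly_even_half k0 (big _ (ltnSn r))).
apply: leq_trans (IH _ _); last 2 first.
- by move=> a lt; apply: sub; lia.
- by move=> a lt; apply: big; lia.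
rewrite expnS mulnA leq_mul2r; apply/orP; right; apply: leq_trans h.
rewrite leq_mul2r; apply/orP; right.
apply/subset_leq_card/subsetP => S; rewrite !inE.
rewrite -[r.+2]addn1 iotaD all_cat add0n => /andP[qS]; rewrite /= andbT => cS.
apply/andP; split; first exact: qS.
have cr : nearly_even (2 * k) S (P r).
  by apply: (allP qS r); rewrite mem_iota; lia.
have sPr := sub r (ltnSn r).
have e1 : #|P r.+1| = #|P r| + #|C|.
  by rewrite -(cardsID (P r) (P r.+1)) (setIidPr sPr).
have e2 : #|S :&: P r.+1| = #|S :&: P r| + #|S :&: C|.
  rewrite -(cardsID (P r) (S :&: P r.+1)) -setIA (setIidPr sPr).
  by rewrite /C setIDA.
(* Two imbalances of at most $2k-1$ differ by at most $4k-2$, hence the parameter [(4 * k).-1] for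
   the increment. *)
move: cr cS; rewrite /nearly_even e1 e2 -setIA setIid -/C; lia.
Qed.

(** Union bound: the bad families cover at most $m 2^{|T|-r}$ sets, which is less than
    $2^{|T|}/(|T|+1)$ and so less than the number of sets of size [h]. *)
Lemma exists_balanced_avoiding h r m (bad : 'I_m -> {set {set T}}) :
  #|T| = h.*2 -> m * #|T|.+1 < 2 ^ r ->
  (forall i, #|bad i| * 2 ^ r <= 2 ^ #|T|) ->
  exists2 S : {set T}, #|S| = h & forall i, S \notin bad i.
Proof.
move=> cT lt_m hbad.
pose D := [set S : {set T} | #|S| == h].
have cD : #|D| = 'C(#|T|, h) by rewrite card_draws.
have : ~~ (D \subset \bigcup_i bad i).
  apply/negP => /subset_leq_card le1.
  have le2 : #|\bigcup_i bad i| <= \sum_i #|bad i|.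
    elim/big_rec2: _ => [|i x y _ le]; first by rewrite cards0.
    by apply: leq_trans (leq_card_setU _ _) _; rewrite leq_add2l.
  have le3 : #|D| * 2 ^ r <= m * 2 ^ #|T|.
    apply: (@leq_trans ((\sum_i #|bad i|) * 2 ^ r)).
      by rewrite leq_mul2r (leq_trans le1 le2) orbT.
    rewrite big_distrl /= -[X in _ <= X * _](card_ord m) -sum_nat_const.
    exact: leq_sum.
  have le4 := pow2_le_central_bin #|T|; rewrite {4}cT doubleK -cD in le4.
  have D0 : 0 < #|D| by rewrite cD bin_gt0 cT -addnn leq_addr.
  have : m * 2 ^ #|T| <= m * #|T|.+1 * #|D| by rewrite -mulnA leq_mul2l le4 orbT.
  move=> le5; have := leq_trans le3 le5.
  by rewrite mulnC leq_pmul2r // leqNgt lt_m.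
case/subsetPn => S; rewrite inE => /eqP cS /bigcupP nbad; exists S => // i.
by apply/negP => Si; apply: nbad; exists i.
Qed.
End Counting.

Local Open Scope ring_scope.

(** * Rank of a cut program *)

Lemma mxrank_sum_le (K : fieldType) p q (I : finType) (M : I -> 'M[K]_(p, q)) :
  (\rank (\sum_i M i)%R <= \sum_i \rank (M i))%N.
Proof.
elim/big_rec2: _ => [|i x y _ le]; first by rewrite mxrank0.
by apply: leq_trans (mxrank_add _ _) _; rewrite leq_add2l.
Qed.

Lemma mxrank_factor_le (K : fieldType) p q (T : finType) (Q : {set T})
    (U : 'I_p -> T -> K) (V : T -> 'I_q -> K) :
  (\rank (\matrix_(i, j) \sum_(k in Q) U i k * V k j)%R <= #|Q|)%N.
Proof.
pose U' := \matrix_(i < p, k < #|Q|) U i (enum_val k).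
pose V' := \matrix_(k < #|Q|, j < q) V (enum_val k) j.
suff -> : (\matrix_(i, j) \sum_(k in Q) U i k * V k j) = U' *m V'.
  exact: mulmx_max_rank.
apply/matrixP => i j; rewrite !mxE big_enum_val.
by apply: eq_bigr => k _; rewrite !mxE.
Qed.

(** * Products of polynomials in disjoint sets of variables *)

Definition set_mnm n (V : {set 'I_n}) : 'X_{1..n} :=
  [multinom (i \in V : nat) | i < n].

Section DisjointVariables.
Variables (K : fieldType) (n : nat).
Implicit Types (p q : {mpoly K[n]}) (V P Q : {set 'I_n}).

Lemma in_varsS P Q p : P \subset Q -> in_vars P p -> in_vars Q p.
Proof. by move=> /subsetP sPQ hp m hm i mi; apply/sPQ/(hp m). Qed.

Lemma in_vars0 P : in_vars P (0 : {mpoly K[n]}).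
Proof. by move=> m; rewrite msupp0. Qed.

Lemma in_vars1 P : in_vars P (1 : {mpoly K[n]}).
Proof. by move=> m; rewrite msupp1 inE => /eqP-> i; rewrite mnm0E. Qed.

Lemma in_varsX P i : i \in P -> in_vars P ('X_i : {mpoly K[n]}).
Proof.
move=> iP m; rewrite msuppX inE => /eqP-> j; rewrite mnm1E eqb0 negbK.
by move/eqP <-.
Qed.

Lemma in_varsD P p q : in_vars P p -> in_vars P q -> in_vars P (p + q).
Proof.
by move=> hp hq m /msuppD_le; rewrite mem_cat => /orP[/hp|/hq].
Qed.

Lemma in_varsZ P c p : in_vars P p -> in_vars P (c *: p).
Proof. by move=> hp m /msuppZ_le/hp. Qed.

Lemma in_varsM P p q : in_vars P p -> in_vars P q -> in_vars P (p * q).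
Proof.
move=> hp hq m /msuppM_le/allpairsP[[m1 m2] /= [h1 h2 ->]] i.
rewrite mnmDE addn_eq0 negb_and => /orP[]; [exact: hp|exact: hq].
Qed.

Lemma in_vars_sum P (I : Type) (r : seq I) (A : pred I) (f : I -> {mpoly K[n]}) :
  (forall i, A i -> in_vars P (f i)) -> in_vars P (\sum_(i <- r | A i) f i).
Proof.
move=> hf; apply: (big_ind (in_vars P)) => //; first exact: in_vars0.
exact: in_varsD.
Qed.

(** In the convolution only one splitting of the monomial survives: its part in [P] for [p] and the
    rest for [q]. *)
Lemma mcoeffM_in_vars P V p q : in_vars P p -> in_vars (~: P) q ->
  (p * q)@_(set_mnm V) = p@_(set_mnm (V :&: P)) * q@_(set_mnm (V :\: P)).
Proof.
move=> hp hq; set m := set_mnm V.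
pose m1 := set_mnm (V :&: P); pose m2 := set_mnm (V :\: P).
have mE : m = (m1 + m2)%MM.
  apply/mnmP => i; rewrite mnmDE !mnmE !inE.
  by case: (i \in V); case: (i \in P).
have l1 : (mdeg m1 < (mdeg m).+1)%N by rewrite mE mdegD ltnS leq_addr.
have l2 : (mdeg m2 < (mdeg m).+1)%N by rewrite mE mdegD ltnS leq_addl.
rewrite mcoeffM (bigD1 (BMultinom l1, BMultinom l2)) /=; last exact/eqP.
rewrite big1 ?addr0 // => -[[k1 h1] [k2 h2]] /= /andP[/eqP Ek neq].
case: (eqVneq p@_k1 0) => [->|nz1]; first by rewrite mul0r.
case: (eqVneq q@_k2 0) => [->|nz2]; first by rewrite mulr0.
case/negP: neq; rewrite -mcoeff_msupp in nz1; rewrite -mcoeff_msupp in nz2.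
have [e1 e2] : k1 = m1 /\ k2 = m2.
  have E i : (k1 i = m1 i) /\ (k2 i = m2 i).
    have := congr1 (fun x : 'X_{1..n} => x i) Ek.
    rewrite mE !mnmDE !mnmE !inE; have := hp _ nz1 i; have := hq _ nz2 i.
    rewrite inE; case: (i \in P) => /=.
      move=> h _; have -> : k2 i = 0%N by case: (k2 i) h => // x /(_ isT).
      by rewrite ?andbT ?andbF; lia.
    move=> _ h; have -> : k1 i = 0%N by case: (k1 i) h => // x /(_ isT).
    by rewrite ?andbT ?andbF; lia.
  by split; apply/mnmP => i; case: (E i).
by apply/eqP; congr (_, _); apply/val_inj.
Qed.

(* Fixing the parts of the row outside [P] and of the column inside [P] makes
   each summand a rank one matrix. *)
Lemma mxrank_cut_le (I : finType) (f g : I -> {mpoly K[n]}) P (S : {set 'I_n})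
    t (rows cols : 'I_t -> {set 'I_n}) :
  (forall u, in_vars P (f u)) -> (forall u, in_vars (~: P) (g u)) ->
  (forall i, rows i \subset S) -> (forall i, cols i \subset ~: S) ->
  (\rank (\matrix_(i, j) (\sum_u f u * g u)@_(set_mnm (rows i :|: cols j)))%R
     <= #|I| * 2 ^ (#|P :\: S| + #|S :\: P|))%N.
Proof.
move=> hf hg hr hc.
have -> : \matrix_(i, j) (\sum_u f u * g u)@_(set_mnm (rows i :|: cols j))
  = \sum_u \matrix_(i, j) (f u * g u)@_(set_mnm (rows i :|: cols j)).
  by apply/matrixP => i j; rewrite mxE summxE raddf_sum; apply: eq_bigr => u _; rewrite mxE.
apply: leq_trans (mxrank_sum_le _) _.
rewrite -[#|I|]/#|xpredT| -sum_nat_const; apply: leq_sum => u _.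
pose Q := setX (powerset (P :\: S)) (powerset (S :\: P)).
have cQ : #|Q| = (2 ^ (#|P :\: S| + #|S :\: P|))%N.
  by rewrite cardsX !card_powerset expnD.
rewrite -cQ.
(* The index [k] pairs a possible trace of the column on [P :\: S] with a possible trace of the row
   on [S :\: P]. The indicators keep only the actual pair of traces. *)
pose U i (k : {set 'I_n} * {set 'I_n}) :=
  (f u)@_(set_mnm ((rows i :&: P) :|: k.1)) * (rows i :\: P == k.2)%:R.
pose V (k : {set 'I_n} * {set 'I_n}) j :=
  (cols j :&: P == k.1)%:R * (g u)@_(set_mnm (k.2 :|: (cols j :\: P))).
suff -> : \matrix_(i, j) (f u * g u)@_(set_mnm (rows i :|: cols j))
    = \matrix_(i, j) \sum_(k in Q) U i k * V k j by exact: mxrank_factor_le.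
apply/matrixP => i j; rewrite !mxE.
have inQ : (cols j :&: P, rows i :\: P) \in Q.
  rewrite !inE /=; apply/andP; split; apply/subsetP => x; rewrite !inE.
    by case/andP=> /(subsetP (hc j)); rewrite inE => -> ->.
  by case/andP=> -> /(subsetP (hr i)) ->.
rewrite (bigD1 _ inQ) /= big1 ?addr0; last first.
  move=> [b a] /andP[_ neq]; rewrite /U /V /=.
  case: (eqVneq (rows i :\: P) a) => [ea|]; last by rewrite mulr0 mul0r.
  case: (eqVneq (cols j :&: P) b) => [eb|]; last by rewrite mul0r mulr0.
  by rewrite ea eb eqxx in neq.
by rewrite /U /V /= !eqxx mulr1 mul1r (mcoeffM_in_vars _ (hf u) (hg u)) setIUl setDUl.
Qed.

End DisjointVariables.

(** * Cutting a branching program at a layer *)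

Section Walks.
Variables (A : pzSemiRingType) (d : nat) (B : abp A d).

Fixpoint walks (n : nat) (u v : abp_node B) : A :=
  if n is n'.+1 then \sum_(x | abp_edge u x) abp_label u x * walks n' x v
  else (u == v)%:R.

(** Turns the sum over tuples in [abp_eval] into a recursion on the first edge. *)
Lemma sum_path_walks n u v :
  \sum_(p : n.-tuple (abp_node B) | path (@abp_edge _ _ B) u p && (last u p == v))
     \prod_(a <- pairmap (@abp_label _ _ B) u p) a = walks n u v.
Proof.
elim: n u => [|n IH] u /=.
  rewrite (eq_bigr (fun=> 1)); last by move=> p _; rewrite (tuple0 p) big_nil.
  rewrite (eq_bigl (fun=> u == v)); last by move=> p; rewrite (tuple0 p).
  case: (u == v); last by rewrite big_pred0.
  by rewrite big_const card_tuple expn0 /= addr0.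
under [RHS]eq_bigr => x _ do rewrite -IH big_distrr /=.
rewrite pair_big_dep /=.
rewrite (reindex (fun xp : abp_node B * n.-tuple _ => [tuple of xp.1 :: xp.2])) /=.
  by apply: eq_big => -[x p] /=; rewrite ?andbA // big_cons.
exists (fun p : n.+1.-tuple _ => (thead p, [tuple of behead p])) => [[x p] _|p _] /=.
  by congr (_, _); apply/val_inj.
by rewrite [RHS]tuple_eta; apply/val_inj.
Qed.

(** The law of powers of the weighted adjacency matrix; [x] is the node reached after [a] steps. *)
Lemma walksD a b u v : walks (a + b) u v = \sum_x walks a u x * walks b x v.
Proof.
elim: a u => [|a IH] u /=.
  rewrite (bigD1 u) //= eqxx mul1r big1 ?addr0 // => x.
  by rewrite eq_sym => /negbTE->; rewrite mul0r.
under eq_bigr => x _ do rewrite IH big_distrr /=.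
rewrite exchange_big /=; apply: eq_bigr => x _; rewrite big_distrl /=.
by apply: eq_bigr => y _; rewrite mulrA.
Qed.

Lemma walks_layer n u v :
  abp_layer v != (abp_layer u + n)%N :> nat -> walks n u v = 0.
Proof.
elim: n u => [|n IH] u /=.
  by rewrite addn0; case: (eqVneq u v) => // ->; rewrite eqxx.
by move=> neq; apply: big1 => x /abp_edge_layer e; rewrite IH ?mulr0 // e addSnnS.
Qed.

End Walks.

(** * The rank bound for a single program *)

Section SparseROABP.
Variables (K : fieldType) (N d t : nat) (B : abp {mpoly K[N]} d).
Variable X : 'I_d -> {set 'I_N}.
Hypothesis equiX : equipartition X.
Hypothesis labelX : forall (i : 'I_d) (u v : abp_node B),
  abp_edge u v -> abp_layer u = i :> nat ->
  [/\ in_vars (X i) (abp_label u v), multilinear (abp_label u v)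
    & sparse t (abp_label u v)].

Lemma walks_in_vars (Q : {set 'I_N}) n (u v : abp_node B) :
  (forall i : 'I_d, abp_layer u <= i < abp_layer u + n -> X i \subset Q)%N ->
  in_vars Q (walks n u v).
Proof.
elim: n u => [|n IH] u hQ /=.
  by case: (u == v); [exact: in_vars1|exact: in_vars0].
apply: in_vars_sum => x ux; have e := abp_edge_layer ux.
have lt : (abp_layer u < d)%N by have := ltn_ord (abp_layer x); lia.
apply: in_varsM; last by apply: IH => i hi; apply: hQ; lia.
have [hl _ _] := labelX ux (erefl : nat_of_ord (abp_layer u) = Ordinal lt).
by apply: in_varsS hl; apply: hQ => /=; lia.
Qed.

Definition prefix_vars a : {set 'I_N} := \bigcup_(i < d | (i < a)%N) X i.

Lemma prefix_vars_S a (lt : (a < d)%N) :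
  prefix_vars a.+1 = X (Ordinal lt) :|: prefix_vars a.
Proof.
rewrite /prefix_vars (bigD1 (Ordinal lt)) //=; congr (_ :|: _).
by apply: eq_bigl => i; rewrite -val_eqE /=; lia.
Qed.

Lemma disjoint_prefix_vars a (i : 'I_d) : (a <= i)%N ->
  [disjoint X i & prefix_vars a].
Proof.
have [dX _ _] := equiX.
move=> le; apply/bigcup_disjointP => j lt; apply: dX.
by rewrite -val_eqE /=; lia.
Qed.

Lemma card_prefix_vars a : (a <= d)%N -> (#|prefix_vars a| * d = a * N)%N.
Proof.
have [dX _ cX] := equiX.
elim: a => [|a IH] le.
  by rewrite /prefix_vars big_pred0 // cards0.
have := disjoint_prefix_vars (leqnn (Ordinal le : 'I_d)).
rewrite (prefix_vars_S le) /= -leq_card_setU => /eqP ->.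
by rewrite mulnDl cX IH ?(ltnW le) // mulSn.
Qed.

Lemma prefix_varsS a b : (a <= b)%N -> prefix_vars a \subset prefix_vars b.
Proof.
move=> le; apply/bigcupsP => i lt; apply: (bigcup_sup i); lia.
Qed.

(** Every source-to-sink walk crosses layer [a] in exactly one node [u]; before it only the first
    [a] blocks are read, after it only the others. *)
Lemma abp_eval_cut a : (a <= d)%N ->
  exists f g : abp_node B -> {mpoly K[N]},
    [/\ abp_eval B = \sum_u f u * g u,
        forall u, in_vars (prefix_vars a) (f u)
      & forall u, in_vars (~: prefix_vars a) (g u)].
Proof.
move=> le_ad.
exists (walks a (abp_src B)).
(* The sum runs over all nodes. Off layer [a] the first factor vanishes anyway, and the value 0
   keeps the second factor in the right variables. *)
exists (fun u => if abp_layer u == a :> nat then walks (d - a) u (abp_snk B) else 0).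
split.
- rewrite /abp_eval sum_path_walks.
  have -> : walks d (abp_src B) (abp_snk B) = walks (a + (d - a)) (abp_src B) (abp_snk B).
    by rewrite subnKC.
  rewrite walksD.
  apply: eq_bigr => u _; case: eqVneq => // neq.
  by rewrite walks_layer ?mul0r ?mulr0 // abp_src_layer.
- move=> u; apply: walks_in_vars => i; rewrite abp_src_layer add0n => lt.
  exact: (bigcup_sup i).
- move=> u; case: eqVneq => [e|_]; last exact: in_vars0.
  apply: walks_in_vars => i; rewrite e => /andP[le _].
  by rewrite -disjoints_subset; apply: disjoint_prefix_vars.
Qed.

(** A chunk consists of [d %/ r] blocks of $N/d$ variables. Since [r <= d], rounding down loses at
    most a factor 2, so a chunk has at least $N/(2r)$ variables; this turns 64 into 128. *)
Lemma card_prefix_chunk r k a : (0 < r <= d)%N -> (128 * k ^ 2 * r <= N)%N ->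
  (a < r)%N ->
  (64 * k ^ 2 <= #|prefix_vars (a.+1 * (d %/ r)) :\: prefix_vars (a * (d %/ r))|)%N.
Proof.
case/andP=> r0 le_rd leN lt_ar; set q := (d %/ r)%N.
have le_qd : (a.+1 * q <= d)%N.
  by apply: leq_trans (leq_trunc_div d r); rewrite -/q mulnC leq_mul2l lt_ar orbT.
have d0 : (0 < d)%N by apply: leq_trans le_rd.
have le_q : (a * q <= a.+1 * q)%N by rewrite leq_mul2r leqnSn orbT.
have c1 := card_prefix_vars le_qd; have c2 := card_prefix_vars (leq_trans le_q le_qd).
rewrite cardsD (setIidPr (prefix_varsS le_q)) -(leq_pmul2r d0) mulnBl c1 c2.
rewrite -mulnBl -mulnBl subSnn mul1n.
have lt_d : (d < q.+1 * r)%N by apply: ltn_ceil.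
have q0 : (0 < q)%N by rewrite divn_gt0.
apply: (@leq_trans (q * (128 * k ^ 2 * r))); last by rewrite leq_mul2l leN orbT.
apply: (@leq_trans (64 * k ^ 2 * (2 * q * r))); last by rewrite [X in (_ <= X)%N]mulnCA; lia.
rewrite leq_mul2l; apply/orP; right; nia.
Qed.

(** The bad sets are those nearly even at all [r.+1] cuts; any other [S] has an imbalance of at
    least [2 * k] at some cut, where the program is split. The factor [2 ^ (2 * k)] stands on the
    left to avoid a division. *)
Lemma sparse_roabp_low_rank r k h : (0 < k)%N -> (0 < r <= d)%N ->
  (128 * k ^ 2 * r <= N)%N -> N = h.*2 ->
  exists2 bad : {set {set 'I_N}}, (#|bad| * 2 ^ r <= 2 ^ N)%N &
    forall S : {set 'I_N}, S \notin bad -> #|S| = h ->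
    forall n (rows cols : 'I_n -> {set 'I_N}),
    (forall i, rows i \subset S) -> (forall i, cols i \subset ~: S) ->
    (\rank (\matrix_(i, j) (abp_eval B)@_(set_mnm (rows i :|: cols j)))%R
       * 2 ^ (2 * k) <= abp_size B * 2 ^ h)%N.
Proof.
move=> k0 rd leN Nh; pose q := (d %/ r)%N; pose P a := prefix_vars (a * q).
exists [set S : {set 'I_N} |
         all (fun a => nearly_even (2 * k) S (P a)) (iota 0 r.+1)].
  rewrite -[X in (_ <= 2 ^ X)%N](card_ord N).
  apply: card_nearly_even_chain => //.
  - by rewrite /P mul0n /prefix_vars big_pred0.
  - by move=> a _; apply: prefix_varsS; rewrite leq_mul2r leqnSn orbT.
  - by move=> a lt; apply: card_prefix_chunk.
move=> S; rewrite inE -has_predC => /hasP[a]; rewrite mem_iota add0n ltnS.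
move=> /andP[_ le_ar] /= far cS n rows cols hr hc.
have le_ad : (a * q <= d)%N.
  by apply: leq_trans (leq_trunc_div d r); rewrite -/q mulnC leq_mul2l le_ar orbT.
have [f [g [-> hf hg]]] := abp_eval_cut le_ad.
(* The excess of [S] on [Q] gives $|Q \setminus S| + |S \setminus Q| \le h - 2k$. *)
have base (Q : {set 'I_N}) (f' g' : abp_node B -> {mpoly K[N]}) :
    (forall u, in_vars Q (f' u)) -> (forall u, in_vars (~: Q) (g' u)) ->
    (#|Q| + 2 * k <= 2 * #|S :&: Q|)%N ->
    (\rank (\matrix_(i, j) (\sum_u f' u * g' u)@_(set_mnm (rows i :|: cols j)))%R
       * 2 ^ (2 * k) <= abp_size B * 2 ^ h)%N.
  move=> hf' hg' big.
  apply: (@leq_trans (abp_size B * 2 ^ (#|Q :\: S| + #|S :\: Q|) * 2 ^ (2 * k))).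
    by rewrite leq_mul2r (mxrank_cut_le hf' hg' hr hc) orbT.
  rewrite -mulnA -expnD leq_mul2l; apply/orP; right.
  rewrite leq_exp2l //; have := cardsID Q S; have := cardsID S Q.
  by move: big; rewrite (setIC Q S) cS; lia.
move: far; rewrite /nearly_even negb_and -!leqNgt => /orP[far|far].
  exact: base hf hg far.
(* A deficit of [S] on [P a] is an excess on the complement, so the two factors exchange roles. *)
under eq_bigr do rewrite mulrC.
apply: (base (~: P a)) => //; first by move=> u; rewrite setCK; exact: hf.
have := cardsID (P a) S; have := cardsC (P a).
move: far Nh; rewrite card_ord setDE cS.
move: #|_| #|S :&: P a| #|~: _| #|_| => x y z w; lia.
Qed.

End SparseROABP.

(** * Nonsingularity of the Raz-Yehudayoff polynomial *)

Section TopCoefficient.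
Variable F : fieldType.

Lemma coefM_top (p q : {poly F}) a b : (size p <= a.+1)%N -> (size q <= b.+1)%N ->
  (p * q)`_(a + b) = p`_a * q`_b.
Proof.
move=> sp sq; have lt : (a < (a + b).+1)%N by rewrite ltnS leq_addr.
rewrite coefM (bigD1 (Ordinal lt)) //= addKn big1 ?addr0 // => i.
rewrite -val_eqE /= neq_ltn => /orP[lt_i|lt_i].
  by rewrite [q`__]nth_default ?mulr0 //; apply: leq_trans sq _; lia.
by rewrite nth_default ?mul0r //; apply: leq_trans sp _.
Qed.

Lemma coef_prod_top n (p : 'I_n -> {poly F}) E :
  (forall i, size (p i) <= E.+1)%N ->
  (size (\prod_i p i)%R <= (n * E).+1)%N
  /\ (\prod_i p i)`_(n * E) = \prod_i (p i)`_E.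
Proof.
elim: n p => [|n IH] p hp; first by rewrite !big_ord0 size_poly1 coefC.
rewrite !big_ord_recl mulSn.
have [s e] := IH (fun i => p (lift ord0 i)) (fun i => hp _).
split; last by rewrite coefM_top // e.
apply: leq_trans (size_polyMleq _ _) _; move: s (hp ord0).
by move: (size _) (size _) => x y; lia.
Qed.

(** Each Leibniz term is a product of [n] entries of degree at most [E], so taking top coefficients
    commutes with the determinant. *)
Lemma coef_det_top n (M : 'M[{poly F}]_n) E :
  (forall i j, size (M i j) <= E.+1)%N ->
  (\det M)`_(n * E) = \det (\matrix_(i, j) (M i j)`_E).
Proof.
move=> hM; rewrite /determinant coef_sum; apply: eq_bigr => s _.
rewrite !mulr_sign.
have [_ e] := coef_prod_top (fun i => hM i (s i)).
have -> : \prod_i (\matrix_(i, j) (M i j)`_E) i (s i) = \prod_i (M i (s i))`_E.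
  by apply: eq_bigr => i _; rewrite mxE.
by case: (s : bool); rewrite ?coefN e.
Qed.

End TopCoefficient.

(* [a] encodes a multilinear monomial in the 1-based variables, and
   [ry_coef w n i j a] is its coefficient in the polynomial g_{i,j} of weights
   [w], only the indices in [i, j] being relevant. *)
Fixpoint ry_coef (A : pzRingType) (w : nat -> nat -> nat -> A) (n i j : nat)
    (a : nat -> bool) : A :=
  if n is n'.+1 then
    if itv_len i j == 0%N then 1
    else (a i == a j)%:R * ry_coef w n' i.+1 j.-1 a
         + \sum_(i.+1 <= k < j.-1 | ~~ odd (itv_len i k))
             w i k j * (ry_coef w n' i k a * ry_coef w n' k.+1 j a)
  else 1.

(** Allows the weights to be specialised inside a coefficient, and fractions to be traded for
    polynomials. *)
Lemma rmorph_ry_coef (A B : pzRingType) (f : {rmorphism A -> B}) w n i j a :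
  f (ry_coef w n i j a) = ry_coef (fun i k j => f (w i k j)) n i j a.
Proof.
elim: n i j => [|n IH] i j /=; first by rewrite rmorph1.
case: ifP => _; first by rewrite rmorph1.
rewrite rmorphD rmorphM rmorph_nat IH rmorph_sum; congr (_ + _).
by apply: eq_bigr => k _; rewrite !rmorphM !IH.
Qed.

Lemma eq_ry_coef (A : pzRingType) (w w' : nat -> nat -> nat -> A) n i j a :
  (forall i k j, w i k j = w' i k j) -> ry_coef w n i j a = ry_coef w' n i j a.
Proof.
move=> e; elim: n i j => [|n IH] i j //=; rewrite IH.
by under eq_bigr => k _ do rewrite e !IH.
Qed.

(** * Multilinear coefficients of the polynomials $g_{i,j}$ *)

Section Coefficients.
Variables (F : fieldType) (N : nat).

Definition itv_set i j : {set 'I_N} := [set o : 'I_N | i <= o.+1 <= j]%N.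

Lemma set_mnm_inj : injective (@set_mnm N).
Proof.
move=> V W e; apply/setP => o.
have := congr1 (fun m : 'X_{1..N} => m o) e; rewrite !mnmE.
by case: (o \in V); case: (o \in W).
Qed.

(** Accounts for the factor [(a i == a j)%:R] in [ry_coef]: the two monomials contain both variables
    or neither. *)
Lemma mcoeff_1DXX (K : fieldType) (o1 o2 : 'I_N) (b : 'I_N -> bool) : o1 != o2 ->
  (1 + 'X_o1 * 'X_o2 : {mpoly K[N]})@_(set_mnm [set o in [set o1; o2] | b o])
    = (b o1 == b o2)%:R.
Proof.
move=> neq; set W := [set o in _ | _].
have m0 : 0%MM = set_mnm (set0 : {set 'I_N}).
  by apply/mnmP => o; rewrite mnm0E mnmE inE.
have m2 : (U_(o1) + U_(o2))%MM = set_mnm [set o1; o2].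
  apply/mnmP => o; rewrite mnmDE !mnm1E mnmE !inE ![o == _]eq_sym.
  by case: eqP => [<-|_] //=; rewrite eq_sym (negbTE neq).
rewrite mcoeffD mcoeff1 -mpolyXD mcoeffX m0 m2 !(inj_eq set_mnm_inj).
have W1 : (o1 \in W) = b o1 by rewrite !inE eqxx.
have W2 : (o2 \in W) = b o2 by rewrite !inE eqxx orbT.
have -> : (W == set0) = ~~ b o1 && ~~ b o2.
  apply/eqP/andP => [e|[b1 b2]]; first by rewrite -W1 -W2 e !inE.
  apply/setP => o; rewrite !inE; apply/negP => /andP[/orP[]/eqP-> bo].
    by rewrite bo in b1.
  by rewrite bo in b2.
have -> : ([set o1; o2] == W) = b o1 && b o2.
  apply/eqP/andP => [e|[b1 b2]]; first by rewrite -W1 -W2 -e !inE !eqxx orbT.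
  apply/setP => o; rewrite !inE.
  by case: eqP => [->|_] /=; [rewrite b1|case: eqP => [->|]].
by case: (b o1); case: (b o2); rewrite /= ?addr0 ?add0r.
Qed.

Lemma xvarE i (lt : (i < N)%N) : xvar F N i.+1 = 'X_(Ordinal lt).
Proof. by rewrite /xvar /= insubT. Qed.

(** The two claims are proved together: the products in the recurrence have factors in disjoint
    variables, which is what makes their coefficients multiply. *)
Lemma mcoeff_ry_rec n i j (a : nat -> bool) :
  (itv_len i j <= n)%N -> (0 < i)%N -> (j <= N)%N -> ~~ odd (itv_len i j) ->
  in_vars (itv_set i j) (ry_rec F N n i j) /\
  (ry_rec F N n i j)@_(set_mnm [set o in itv_set i j | a o.+1])
    = ry_coef (wvar F N) n i j a.
Proof.
have empty i' j' : itv_len i' j' = 0%N -> itv_set i' j' = set0.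
  by rewrite /itv_len => e; apply/setP => o; rewrite !inE; lia.
have base i' j' : itv_len i' j' = 0%N ->
    in_vars (itv_set i' j') (1 : {mpoly (ratW F N)[N]}) /\
    (1 : {mpoly (ratW F N)[N]})@_(set_mnm [set o in itv_set i' j' | a o.+1]) = 1.
  move=> e; split; first exact: in_vars1.
  rewrite empty // mcoeff1; set m := set_mnm _.
  suff -> : m = 0%MM by rewrite eqxx.
  by apply/mnmP => o; rewrite mnmE !inE mnm0E.
elim: n i j => [|n IH] i j len_n i0 jN ev.
  by apply: base; apply/eqP; rewrite -leqn0.
rewrite [ry_rec _ _ _ _ _]/= [ry_coef _ _ _ _ _]/=.
case: eqP => [/base //|len].
have lt_ij : (i < j)%N by move: len ev; rewrite /itv_len; lia.
have lti : (i.-1 < N)%N by lia.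
have ltj : (j.-1 < N)%N by lia.
have xi : xvar F N i = 'X_(Ordinal lti) by rewrite -xvarE prednK.
have xj : xvar F N j = 'X_(Ordinal ltj) by rewrite -xvarE prednK //; lia.
set oi := Ordinal lti in xi *; set oj := Ordinal ltj in xj *.
have neq : oi != oj by rewrite -val_eqE /=; lia.
have [v1 e1] := IH i.+1 j.-1 ltac:(move: len_n; rewrite /itv_len; lia) (ltn0Sn _) ltac:(lia) ltac:(move: ev; rewrite /itv_len; lia).
have v0 : in_vars [set oi; oj] (1 + xvar F N i * xvar F N j).
  rewrite xi xj; apply: in_varsD; first exact: in_vars1.
  by apply: in_varsM; apply: in_varsX; rewrite !inE eqxx ?orbT.
have hk k : (i.+1 <= k < j.-1)%N -> ~~ odd (itv_len i k) ->
   [/\ in_vars (itv_set i k) (ry_rec F N n i k),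
       in_vars (itv_set k.+1 j) (ry_rec F N n k.+1 j) &
      (ry_rec F N n i k * ry_rec F N n k.+1 j)@_(set_mnm [set o in itv_set i j | a o.+1])
      = ry_coef (wvar F N) n i k a * ry_coef (wvar F N) n k.+1 j a].
  move=> rk ek.
  have [vk ck] := IH i k ltac:(move: len_n; rewrite /itv_len; lia) i0 ltac:(lia) ek.
  have [vk' ck'] := IH k.+1 j ltac:(move: len_n; rewrite /itv_len; lia) (ltn0Sn _) jN ltac:(move: ev ek; rewrite /itv_len; lia).
  split => //; rewrite (mcoeffM_in_vars (P := itv_set i k)) //; last first.
    by apply: in_varsS vk'; apply/subsetP => o; rewrite !inE; lia.
  rewrite -ck -ck'; congr (_ * _); congr (mcoeff (set_mnm _) _).
    by apply/setP => o; rewrite !inE; case: (a _); rewrite ?andbF ?andbT //; lia.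
  by apply/setP => o; rewrite !inE; case: (a _); rewrite ?andbF ?andbT //; lia.
split.
  apply: in_varsD.
    apply: in_varsM.
      by apply: in_varsS v0; apply/subsetP => o; rewrite !inE -!val_eqE /=; lia.
    by apply: in_varsS v1; apply/subsetP => o; rewrite !inE; lia.
  rewrite big_nat_cond; apply: in_vars_sum => k /andP[rk ek].
  have [vk vk' _] := hk k rk ek; apply: in_varsZ; apply: in_varsM.
    by apply: in_varsS vk; apply/subsetP => o; rewrite !inE; lia.
  by apply: in_varsS vk'; apply/subsetP => o; rewrite !inE; lia.
rewrite mcoeffD; congr (_ + _).
  rewrite (mcoeffM_in_vars (P := [set oi; oj])) //; last first.
    by apply: in_varsS v1; apply/subsetP => o; rewrite !inE -!val_eqE /=; lia.
  rewrite -e1; congr (_ * _); last congr (mcoeff (set_mnm _) _).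
    have -> : [set o in itv_set i j | a o.+1] :&: [set oi; oj] =
      [set o in [set oi; oj] | a o.+1].
      apply/setP => o; rewrite !inE -!val_eqE /=.
      by case: (a _); rewrite ?andbF ?andbT //; lia.
    rewrite xi xj (mcoeff_1DXX _ (fun o => a o.+1) neq) /= !prednK //; lia.
  apply/setP => o; rewrite !inE -!val_eqE /=.
  by case: (a _); rewrite ?andbF ?andbT //; lia.
rewrite [in LHS]big_nat_cond raddf_sum [RHS]big_nat_cond /=; apply: eq_bigr => k /andP[rk ek].
by have [_ _ e] := hk k rk ek; rewrite mcoeffZ e.
Qed.

End Coefficients.

(** * Balanced intervals and how they split *)

Definition balanced (s : nat -> bool) (i j : nat) : bool :=
  (2 * \sum_(i <= x < j.+1) s x == itv_len i j)%N.

Section Balanced.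
Variable s : nat -> bool.

Lemma balanced_even i j : balanced s i j -> ~~ odd (itv_len i j).
Proof. by move/eqP <-; rewrite mul2n odd_double. Qed.

Lemma balanced_cat i k j : (i <= k)%N -> (k <= j)%N ->
  balanced s i k -> balanced s i j -> balanced s k.+1 j.
Proof.
move=> ik kj; rewrite /balanced /itv_len (@big_cat_nat _ _ _ k.+1 i j.+1) //=; lia.
Qed.

Lemma balanced_inner i j : (i < j)%N -> s i != s j ->
  balanced s i j -> balanced s i.+1 j.-1.
Proof.
move=> lt; rewrite /balanced /itv_len big_nat_recr /=; last by lia.
rewrite big_ltn // prednK; last by lia.
by move=> ne /eqP h; apply/eqP; case: (s i) (s j) ne h => [] [] //= _; lia.
Qed.

(** Discrete intermediate values: the excess of true over false values on $[i,k]$ moves by steps of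
    one, from 1 at $k=i$ to $-1$ at $k=j-1$. It is 0 at the first [k] where it is not positive. *)
Lemma balanced_split_true i j : (i < j)%N -> s i -> s j -> balanced s i j ->
  exists2 k, (i < k < j.-1)%N & balanced s i k.
Proof.
move=> lt si sj /eqP bal.
pose c k := (\sum_(i <= x < k.+1) s x)%N.
have cS k : (i <= k.+1)%N -> c k.+1 = (c k + s k.+1)%N.
  by move=> le; rewrite /c big_nat_recr.
have ci : c i = 1%N by rewrite /c big_nat1 si.
have cj : (2 * c j.-1 + 2 = itv_len i j)%N.
  by rewrite -bal -/(c j) -[in RHS](@prednK j) ?cS ?prednK ?sj; lia.
rewrite /itv_len in cj.
have ex : exists k, (i <= k)%N && (2 * c k <= k.+1 - i)%N.
  by exists j.-1; lia.
case: (ex_minnP ex) => k /andP[ik le] min.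
have ltk : (k <= j.-1)%N by apply: min; lia.
have nei : k != i by apply/negP => /eqP e; rewrite e ci in le; lia.
have k1 : k = k.-1.+1 by rewrite prednK //; lia.
have ck := cS k.-1 ltac:(lia); rewrite -k1 in ck.
have big : (k.-1.+1 - i < 2 * c k.-1)%N.
  rewrite ltnNge; apply/negP => h.
  by have := min k.-1 ltac:(lia); lia.
exists k; last by rewrite /balanced -/(c k) /itv_len; lia.
have : k != j.-1 by apply/negP => /eqP e; rewrite e in big ck le; lia.
lia.
Qed.

End Balanced.

Lemma balanced_neg s i j : balanced (fun x => ~~ s x) i j = balanced s i j.
Proof.
rewrite /balanced /itv_len.
have : (\sum_(i <= x < j.+1) s x + \sum_(i <= x < j.+1) ~~ s x = j.+1 - i)%N.
  rewrite -big_split /= (eq_bigr (fun=> 1%N)) => [|x _]; last by case: (s x).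
  by rewrite sum_nat_const_nat muln1.
lia.
Qed.

Lemma balanced_split s i j : (i < j)%N -> s i = s j -> balanced s i j ->
  exists2 k, (i < k < j.-1)%N & balanced s i k.
Proof.
move=> lt e bal; case si: (s i); first by apply: balanced_split_true; rewrite -?e.
have [||||k hk] := @balanced_split_true (fun x => ~~ s x) i j; rewrite ?si -?e ?si ?balanced_neg //.
by exists k.
Qed.

(** * The leading term under rapidly growing weights *)

Section LeadingTerm.
Variables (F : fieldType) (N : nat) (s : nat -> bool).

(** The first balanced cut; if there is none, [find] gives a value beyond the range of [k] in the
    recurrence. *)
Definition split_point i j : nat :=
  (i.+1 + find (balanced s i) (index_iota i.+1 j.-1))%N.

Lemma split_pointP i j : (i < j)%N -> s i = s j -> balanced s i j ->
  (i < split_point i j < j.-1)%N /\ balanced s i (split_point i j).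
Proof.
move=> lt e bal; have [k hk bk] := balanced_split lt e bal.
have hs : has (balanced s i) (index_iota i.+1 j.-1).
  by apply/hasP; exists k => //; rewrite mem_index_iota.
have := nth_find 0%N hs; rewrite has_find size_iota in hs.
by rewrite nth_iota // -/(split_point i j); split=> //; rewrite /split_point; lia.
Qed.

(* Powers of the indeterminate fast enough for the chosen split of an interval
   to dominate every other contribution. *)
Definition split_weight i k j : {poly F} :=
  if (s i == s j) && (k == split_point i j) then 'X^(4 ^ itv_len i j) else 0.

Lemma size_split_weight i k j : (size (split_weight i k j) <= (4 ^ itv_len i j).+1)%N.
Proof. by rewrite /split_weight; case: ifP => _; rewrite ?size_polyXn ?size_poly0. Qed.

Variable w : nat -> nat -> nat -> {poly F}.
Hypothesis size_w : forall i k j, (size (w i k j) <= (4 ^ itv_len i j).+1)%N.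
Hypothesis wE : forall i k j, (0 < i)%N -> (i < k < j)%N -> (j <= N)%N ->
  w i k j = split_weight i k j.

(** Both halves of a split are shorter than $[i,j]$ by at least 2, so each contributes at most an
    eighth of $4^{|[i,j]|}$ on top of the weight. *)
Lemma size_ry_coef n i j a : (size (ry_coef w n i j a) <= 2 * 4 ^ itv_len i j)%N.
Proof.
have pos m : (0 < 4 ^ m)%N by rewrite expn_gt0.
elim: n i j => [|n IH] i j /=.
  by rewrite size_poly1; have := pos (itv_len i j); lia.
case: ifP => [_|/negbT len].
  by rewrite size_poly1; have := pos (itv_len i j); lia.
apply: leq_trans (size_polyD _ _) _; rewrite geq_max; apply/andP; split.
  case: eqP => _; last by rewrite mul0r size_poly0.
  rewrite mul1r; apply: leq_trans (IH _ _) _.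
  by rewrite leq_mul2l leq_exp2l // /itv_len; lia.
rewrite big_nat_cond; elim/big_rec: _ => [|k p /andP[hk _] hp].
  by rewrite size_poly0.
apply: leq_trans (size_polyD _ _) _; rewrite geq_max hp andbT.
apply: leq_trans (size_polyMleq _ _) _.
have := IH i k; have := IH k.+1 j; have := size_w i k j.
move: (ry_coef w n i k a) (ry_coef w n k.+1 j a) (w i k j) => c1 c2 v.
have := size_polyMleq c1 c2.
have l1 : (4 ^ 2 * 4 ^ itv_len i k <= 4 ^ itv_len i j)%N.
  by rewrite -expnD leq_exp2l // /itv_len; lia.
have l2 : (4 ^ 2 * 4 ^ itv_len k.+1 j <= 4 ^ itv_len i j)%N.
  by rewrite -expnD leq_exp2l // /itv_len; lia.
have := pos (itv_len i j).
move: (size (c1 * c2)%R) (size c1) (size c2) (size v) l1 l2.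
by move: (4 ^ itv_len i j)%N => *; lia.
Qed.

Definition matching (p : nat -> nat) i j : Prop :=
  forall x, (i <= x <= j)%N ->
    [/\ (i <= p x <= j)%N, s (p x) = ~~ s x & p (p x) = x].

(** The part of degree [E] is the product of $1 + x_y x_{p(y)}$ over the pairs of [p], whose
    coefficients are the indicators of [p]-invariance. [E] and [p] do not depend on the monomial
    [a]. *)
Definition has_leading_matching n i j (E : nat) (p : nat -> nat) : Prop :=
  forall a, (size (ry_coef w n i j a) <= E.+1)%N /\
    exists2 b : bool, (ry_coef w n i j a)`_E = b%:R
      & b <-> (forall x, (i <= x <= j)%N -> a x = a (p x)).

(** Induction on the length: if [s] differs at the endpoints, they are matched with each other;
    otherwise the split term dominates, and the matchings of its two halves are joined. *)
Lemma ry_coef_leading n i j : (itv_len i j <= n)%N -> (0 < i)%N -> (j <= N)%N ->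
  balanced s i j ->
  exists E p, matching p i j /\ has_leading_matching n i j E p.
Proof.
elim: n i j => [|n IH] i j len_n i0 jN bal.
  exists 0%N, id; split; first by move=> x; move: len_n; rewrite /itv_len; lia.
  move=> a; rewrite /= size_poly1; split=> //; exists true => //.
  by rewrite coefC.
case: (eqVneq (itv_len i j) 0%N) => [e|ne].
  exists 0%N, id; split; first by move=> x; move: e; rewrite /itv_len; lia.
  by move=> a; rewrite /= e size_poly1; split=> //; exists true => //; rewrite coefC.
have lt_ij : (i < j)%N by have := balanced_even bal; move: ne; rewrite /itv_len; lia.
(* At most one summand survives: the one at [split_point] if [s i = s j], none otherwise. *)
have coefE a : ry_coef w n.+1 i j a = (a i == a j)%:R * ry_coef w n i.+1 j.-1 a
   + if (s i == s j) then 'X^(4 ^ itv_len i j) * (ry_coef w n i (split_point i j) a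
        * ry_coef w n (split_point i j).+1 j a) else 0.
  rewrite /= (negbTE ne); congr (_ + _); case: eqP => [e|/eqP nsij].
    have [hk bk] := split_pointP lt_ij e bal.
    rewrite big_mkcond (bigD1_seq (split_point i j)) ?iota_uniq ?mem_index_iota //=.
    rewrite (balanced_even bk) wE //; last by lia.
    rewrite /split_weight e !eqxx /= big1_seq ?addr0 // => k /andP[nk].
    rewrite mem_index_iota => rk; rewrite wE //; last by lia.
    by rewrite /split_weight (negbTE nk) andbF mul0r if_same.
  rewrite big1_seq // => k /andP[_]; rewrite mem_index_iota => rk.
  by rewrite wE // /split_weight ?(negbTE nsij) ?mul0r //; lia.
case: (eqVneq (s i) (s j)) coefE => [e|ns] coefE; last first.
  have [||||E [p [mp lp]]] := IH i.+1 j.-1; try (move: len_n; rewrite /itv_len; lia).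
    exact: balanced_inner.
  exists E, (fun x => if x == i then j else if x == j then i else p x).
  have nji : (j == i) = false by lia.
  split.
    move=> x rx; case: (eqVneq x i) => [->|xi].
      by rewrite nji eqxx; split=> //; [lia|case: (s i) (s j) ns => [] []].
    case: (eqVneq x j) => [->|xj].
      by rewrite eqxx; split=> //; [lia|case: (s i) (s j) ns => [] []].
    have [r1 r2 r3] := mp x ltac:(lia).
    have -> : (p x == i) = false by lia.
    have -> : (p x == j) = false by lia.
    by split=> //; lia.
  move=> a; rewrite coefE addr0; have [sz [b eb hb]] := lp a.
  split.
    by case: (_ == _); rewrite ?mul1r // mul0r size_poly0.
  exists ((a i == a j) && b).
    by case: (_ == _); rewrite ?mul1r // mul0r coef0.
  split.
    case/andP => /eqP aij /hb h x rx.
    case: (eqVneq x i) => [->//|xi]; case: (eqVneq x j) => [->//|xj].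
    by apply: h; lia.
  move=> h; have := h i ltac:(lia); rewrite eqxx => ->; rewrite eqxx.
  apply/hb => x rx; have := h x ltac:(lia).
  have -> : (x == i) = false by lia.
  by have -> : (x == j) = false by lia.
have [hk bk] := split_pointP lt_ij e bal; set k := split_point i j in hk bk coefE.
clearbody k.
have [||||E1 [p1 [m1 l1]]] := IH i k => //; try (move: len_n; rewrite /itv_len; lia).
have [||||E2 [p2 [m2 l2]]] := IH k.+1 j => //; try (move: len_n; rewrite /itv_len; lia).
  by apply: balanced_cat bk bal; lia.
exists (4 ^ itv_len i j + (E1 + E2))%N, (fun x => if (x <= k)%N then p1 x else p2 x).
split.
  move=> x rx; case: (leqP x k) => lx.
    have [r1 r2 r3] := m1 x ltac:(lia).
    have -> : (p1 x <= k)%N by lia.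
    by split=> //; lia.
  have [r1 r2 r3] := m2 x ltac:(lia).
  have -> : (p2 x <= k)%N = false by lia.
  by split=> //; lia.
move=> a; rewrite coefE.
have [sz1 [b1 eb1 hb1]] := l1 a; have [sz2 [b2 eb2 hb2]] := l2 a.
(* The term pairing the endpoints has degree below that of the weight, so it never reaches the
   degree of the split term. *)
have sz0 : (size ((a i == a j)%:R * ry_coef w n i.+1 j.-1 a)%R <= 4 ^ itv_len i j)%N.
  case: eqP => _; last by rewrite mul0r size_poly0.
  rewrite mul1r; apply: leq_trans (size_ry_coef _ _ _ _) _.
  apply: (@leq_trans (4 * 4 ^ itv_len i.+1 j.-1)); first by rewrite leq_mul2r orbT.
  by rewrite -expnS leq_exp2l // /itv_len; lia.
split.
  apply: leq_trans (size_polyD _ _) _; rewrite geq_max; apply/andP; split.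
    by apply: leq_trans sz0 _; lia.
  rewrite mulrC; apply: leq_trans (size_polyMleq _ _) _; rewrite size_polyXn.
  move: (ry_coef w n i k a) (ry_coef w n k.+1 j a) sz1 sz2 => c1 c2.
  have := size_polyMleq c1 c2.
  move: (size (c1 * c2)%R) (size c1) (size c2).
  by move: (4 ^ itv_len i j)%N => *; lia.
exists (b1 && b2).
  rewrite coefD [X in X + _]nth_default ?add0r; last by apply: leq_trans sz0 _; lia.
  rewrite coefXnM ltnNge leq_addr /= addKn coefM_top // eb1 eb2.
  by case: b1 b2 {eb1 eb2 hb1 hb2} => [] []; rewrite ?mulr1 ?mulr0.
split.
  case/andP => /hb1 h1 /hb2 h2 x rx; case: (leqP x k) => lx; [apply: h1|apply: h2]; lia.
move=> h; apply/andP; split.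
  by apply/hb1 => x rx; have := h x ltac:(lia); have -> : (x <= k)%N by lia.
by apply/hb2 => x rx; have := h x ltac:(lia); have -> : (x <= k)%N = false by lia.
Qed.

End LeadingTerm.

(** * Specialising the weights, and full rank *)

Section FullRank.
Variables (F : fieldType) (N : nat).

(** The weight before passing to fractions: the specialisation is a morphism on polynomials and may
    kill denominators. *)
Definition wvar_poly (i k j : nat) : {mpoly F[#|Windex N|]} :=
  if (ord_of_index N i, ord_of_index N k, ord_of_index N j)
    is (Some a, Some b, Some c)
  then 'X_(enum_rank ((a, b, c) : Windex N)) else 0.

Lemma wvarE i k j : wvar F N i k j = tofrac (wvar_poly i k j).
Proof.
rewrite /wvar /wvar_poly; case: ord_of_index => [?|]; last by rewrite tofrac0.
case: ord_of_index => [?|]; last by rewrite tofrac0.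
by case: ord_of_index => [?|]; rewrite ?tofrac0.
Qed.

Definition mem_index (S : {set 'I_N}) (x : nat) : bool :=
  if ord_of_index N x is Some o then o \in S else false.

Lemma mem_indexE S (o : 'I_N) : mem_index S o.+1 = (o \in S).
Proof. by rewrite /mem_index /= valK. Qed.

Lemma mem_index_balanced h (S : {set 'I_N}) : N = h.*2 -> #|S| = h ->
  balanced (mem_index S) 1 N.
Proof.
move=> Nh cS; rewrite /balanced /itv_len subSS subn0 big_add1 /= big_mkord.
rewrite (eq_bigr (fun o : 'I_N => (o \in S : nat))) => [|o _]; last by rewrite mem_indexE.
by rewrite -big_mkcond sum1_card cS mul2n -Nh.
Qed.

Variable s : nat -> bool.

Definition split_eval (x : 'I_#|Windex N|) : {poly F} :=
  let: (i, k, j) := (enum_val x : Windex N) in split_weight F s i.+1 k.+1 j.+1.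

Definition specialize : {rmorphism {mpoly F[#|Windex N|]} -> {poly F}} :=
  mmap (polyC : {rmorphism F -> {poly F}}) split_eval.

Lemma ord_of_index_range i :
  if ord_of_index N i is Some o then i = (o : nat).+1 else ~~ (0 < i <= N)%N.
Proof.
by case: i => [|i] //=; case: insubP => [o _ <-|].
Qed.

Lemma specialize_wvar i k j : specialize (wvar_poly i k j) =
  if [&& 0 < i <= N, 0 < k <= N & 0 < j <= N]%N
  then split_weight F s i k j else 0.
Proof.
rewrite /wvar_poly.
have := ord_of_index_range i; case: ord_of_index => [oi ->|/negbTE->]; last first.
  by rewrite raddf0.
have := ord_of_index_range k; case: ord_of_index => [ok ->|/negbTE->]; last first.
  by rewrite andbF raddf0.
have := ord_of_index_range j; case: ord_of_index => [oj ->|/negbTE->]; last first.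
  by rewrite !andbF raddf0.
by rewrite !ltn_ord /= mmapX mmap1U /split_eval enum_rankK.
Qed.

End FullRank.

(* Columns are the images of the rows under the matching, so that the leading
   coefficients form the identity matrix. *)
Lemma ry_poly_full_rank (F : fieldType) N h (S : {set 'I_N}) : N = h.*2 -> #|S| = h ->
  exists (rows cols : 'I_(2 ^ h) -> {set 'I_N}),
    [/\ forall i, rows i \subset S, forall i, cols i \subset ~: S
      & \rank (\matrix_(i, j) (ry_poly F N)@_(set_mnm (rows i :|: cols j)))%R = (2 ^ h)%N].
Proof.
move=> Nh cS; have bal := mem_index_balanced Nh cS; set s := mem_index S in bal.
pose f := specialize F N s.
pose w i k j := f (wvar_poly F N i k j).
have size_w i k j : (size (w i k j) <= (4 ^ itv_len i j).+1)%N.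
  rewrite /w specialize_wvar; case: ifP => _; last by rewrite size_poly0.
  exact: size_split_weight.
have wE i k j : (0 < i)%N -> (i < k < j)%N -> (j <= N)%N -> w i k j = split_weight F s i k j.
  by move=> i0 rk jN; rewrite /w specialize_wvar ifT //; lia.
have len1 : itv_len 1 N = N by rewrite /itv_len; lia.
have [||||E [p [mp lp]]] := ry_coef_leading size_w wE (n := N) (i := 1) (j := N).
- by rewrite len1.
- by [].
- by [].
- exact: bal.
have cP : #|powerset S| = (2 ^ h)%N by rewrite card_powerset cS.
pose rows (i : 'I_(2 ^ h)) := enum_val (cast_ord (esym cP) i).
pose cols i := [set o : 'I_N | (o \notin S) && mem_index (rows i) (p o.+1)].
have rowsS i : rows i \subset S by have := enum_valP (cast_ord (esym cP) i); rewrite inE.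
exists rows, cols; split=> //.
  by move=> i; apply/subsetP => o; rewrite !inE => /andP[].
pose a i j := mem_index (rows i :|: cols j).
(* The matrix already has entries in the polynomial ring, so its determinant can be specialised. *)
pose M0 := \matrix_(i, j) ry_coef (wvar_poly F N) N 1 N (a i j).
have -> : \matrix_(i, j) (ry_poly F N)@_(set_mnm (rows i :|: cols j))
   = map_mx (@tofrac _) M0.
  apply/matrixP => i j; rewrite !mxE rmorph_ry_coef.
  rewrite /ry_poly /ry_itv len1.
  have [||||_ e] := @mcoeff_ry_rec F N N 1 N (a i j); rewrite ?len1 //.
    by rewrite Nh odd_double.
  have <- : [set o in itv_set N 1 N | a i j o.+1] = rows i :|: cols j.
    apply/setP => o; rewrite [LHS]inE /a mem_indexE inE.
    by rewrite ltn_ord.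
  by rewrite e; apply: eq_ry_coef => *; exact: wvarE.
apply: mxrank_unit; rewrite unitmxE unitfE det_map_mx tofrac_eq0.
apply/eqP => det0.
have : f (\det M0) = 0 by rewrite det0 raddf0.
rewrite -det_map_mx => /(congr1 (fun q : {poly F} => q`_(2 ^ h * E))).
rewrite coef_det_top => [|i j]; last first.
  by rewrite !mxE rmorph_ry_coef; case: (lp (a i j)).
(* The set [rows i :|: cols j] is invariant under [p] exactly when [cols j] is the image of
   [rows i], that is, when [i = j]. *)
have -> : \matrix_(i, j) (map_mx f M0 i j)`_E = 1%:M.
  apply/matrixP => i j; rewrite !mxE rmorph_ry_coef.
  have [_ [b -> hb]] := lp (a i j); congr (_%:R); congr nat_of_bool.
  have aS o : o \in S -> a i j o.+1 = (o \in rows i).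
    by move=> oS; rewrite /a mem_indexE !inE oS /= orbF.
  have aC o : o \notin S -> a i j o.+1 = mem_index (rows j) (p o.+1).
    move=> oS; rewrite /a mem_indexE !inE oS /=.
    by case oi: (o \in rows i) => //; rewrite (subsetP (rowsS i)) in oS.
  have ordx x : (1 <= x <= N)%N -> exists o : 'I_N, x = o.+1.
    by case: x => // x lt; exists (Ordinal lt).
  have cross o : o \in S -> a i j (p o.+1) = (o \in rows j).
    move=> oS; have [r1 r2 r3] := mp o.+1 (ltn_ord o).
    have [o' eo'] := ordx _ r1; rewrite eo' aC; last first.
      by move: r2; rewrite eo' /s !mem_indexE oS => ->.
    by rewrite -eo' r3 mem_indexE.
  apply/idP/eqP => [/hb h1|eij].
    apply/(@cast_ord_inj _ _ (esym cP))/enum_val_inj/setP => o.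
    rewrite -/(rows i) -/(rows j).
    case oS: (o \in S); first by rewrite -aS // -cross // -h1 //; exact: ltn_ord.
    by apply/idP/idP => /(subsetP (rowsS _)); rewrite oS.
  apply/hb => x /[dup] rx /ordx[o ex]; rewrite {x}ex in rx *.
  case oS: (o \in S); first by rewrite aS // cross // eij.
  have [r1 r2 r3] := mp o.+1 rx; have [o' eo'] := ordx _ r1.
  have oS' : o' \in S by move: r2; rewrite eo' /s !mem_indexE oS.
  by rewrite aC ?oS // eo' mem_indexE aS // eij.
by rewrite det1 coef0 => /eqP; rewrite oner_eq0.
Qed.

(** The non-asymptotic core: on a balanced set avoiding all bad families, the ranks of the [f i] add
    up to less than [2 ^ h], while the matrix of [ry_poly] has rank [2 ^ h]. *)
Lemma no_small_roabp_sum (F : fieldType) N h r k m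
    (f : 'I_m -> {mpoly (ratW F N)[N]}) :
  N = h.*2 -> (0 < r)%N -> (0 < k)%N -> (128 * k ^ 2 * r <= N)%N ->
  (m * N.+1 < 2 ^ r)%N -> (m <= 2 ^ k)%N ->
  (forall i, exists (d t : nat) (P : abp {mpoly (ratW F N)[N]} d),
     [/\ (r <= d)%N, sparse_roabp t P, abp_eval P = f i & (abp_size P < 2 ^ k)%N]) ->
  ry_poly F N <> \sum_i f i.
Proof.
move=> Nh r0 k0 leN lt_m le_m hf eg.
have hbad i : exists bad : {set {set 'I_N}}, (#|bad| * 2 ^ r <= 2 ^ N)%N /\
    forall S : {set 'I_N}, S \notin bad -> #|S| = h ->
    forall n (rows cols : 'I_n -> {set 'I_N}),
    (forall i, rows i \subset S) -> (forall i, cols i \subset ~: S) ->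
    (\rank (\matrix_(i', j) (f i)@_(set_mnm (rows i' :|: cols j)))%R
       * 2 ^ (2 * k) <= (2 ^ k).-1 * 2 ^ h)%N.
  have [d [t [P [le_rd [X [eX lX]] <- sz]]]] := hf i.
  have rd : (0 < r <= d)%N by rewrite r0.
  have [bad cb hb] := sparse_roabp_low_rank eX lX k0 rd leN Nh.
  exists bad; split=> // S nS cS n rows cols hr hc.
  apply: leq_trans (hb S nS cS n rows cols hr hc) _.
  by rewrite leq_mul2r; apply/orP; right; lia.
have {hbad}[bad hbad] := fin_all_exists hbad.
have [|||S cS nS] := @exists_balanced_avoiding _ h r m bad.
- by rewrite card_ord.
- by rewrite card_ord.
- by move=> i; rewrite card_ord; case: (hbad i).
have [rows [cols [hr hc full]]] := ry_poly_full_rank F Nh cS.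
have le1 : (2 ^ h <= \sum_i \rank (\matrix_(i', j) (f i)@_(set_mnm (rows i' :|: cols j)))%R)%N.
  apply: leq_trans (mxrank_sum_le _); rewrite -[X in (X <= _)%N]full.
  apply: eq_leq; congr (\rank _).
  apply/matrixP => i j; rewrite mxE summxE eg raddf_sum.
  by apply: eq_bigr => l _; rewrite mxE.
have le2 : (2 ^ h * 2 ^ (2 * k) <= m * ((2 ^ k).-1 * 2 ^ h))%N.
  apply: (@leq_trans ((\sum_i \rank (\matrix_(i', j) (f i)@_(set_mnm (rows i' :|: cols j)))%R)
     * 2 ^ (2 * k))); first by rewrite leq_mul2r le1 orbT.
  rewrite big_distrl /= -[X in (_ <= X * _)%N](card_ord m) -sum_nat_const; apply: leq_sum => i _.
  by case: (hbad i) => _ hb; apply: hb.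
have h0 : (0 < 2 ^ h)%N by rewrite expn_gt0.
have k1 : (0 < 2 ^ k)%N by rewrite expn_gt0.
rewrite mulnA [X in (_ <= X)%N]mulnC leq_pmul2l // mul2n -addnn expnD in le2.
move: le2; rewrite leqNgt => /negP; apply.
(* The strict size bound is used here: $m(2^k-1) \le 2^k(2^k-1) < 2^{2k}$. *)
apply: (@leq_ltn_trans (2 ^ k * (2 ^ k).-1)); first by rewrite leq_mul2r le_m orbT.
by rewrite ltn_pmul2l // prednK.
Qed.

(** * Asymptotics *)

Section Asymptotics.
Variable R : realType.
Implicit Types x y : R.

(** The inequality $\ln(1+x) \le x$ at $x = -1/2$. *)
Lemma ln2_ge_half : 1 / 2 <= ln 2 :> R.
Proof.
have := @le_ln1Dx R (- (1 / 2)) ltac:(lra).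
have -> : 1 + - (1 / 2) = 2^-1 :> R by lra.
by rewrite lnV ?posrE ?ltr0n //; lra.
Qed.

Lemma le_pow2D1 x : x <= 2 `^ (x + 1).
Proof.
rewrite powRD; last by rewrite pnatr_eq0 implybT.
rewrite powRr1 ?ler0n // /powR pnatr_eq0 /=.
case: (leP x 0) => [x0|x0].
  by apply: le_trans x0 _; rewrite mulr_ge0 ?ler0n ?expR_ge0.
have := expR_ge1Dx (x * ln 2); have := ln2_ge_half; nra.
Qed.

Lemma log2_ge1 x : 2 <= x -> 1 <= log2 x.
Proof.
move=> x2; rewrite /log2 ler_pdivlMr ?mul1r ?ln_gt0 ?ltr1n //.
by rewrite ler_ln ?posrE ?ltr0n //; apply: lt_le_trans x2; rewrite ltr0n.
Qed.

Lemma ltn_pow2_of_lt_powR n k x : n%:R < 2 `^ x -> x <= k%:R -> (n < 2 ^ k)%N.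
Proof.
move=> lt le; rewrite -(ltr_nat R) natrX -powR_mulrn ?ler0n //.
by apply: lt_le_trans lt _; apply: ler_powR => //; rewrite ler1n.
Qed.

(** With $y = N^{1/440}$, where 440 is the least common multiple of 10, 11 and 40, all exponents
    become natural numbers: [r] is about $N^{1/10}$ and [k] about $N^{9/40}$. *)
Lemma exists_parameters (N : nat) y : 30 <= y -> N%:R = y ^+ 440 ->
  exists r k : nat, [/\ (0 < r)%N, r%:R <= y ^+ 44, y ^+ 99 <= k%:R,
     (128 * k ^ 2 * r <= N)%N
   & forall m : nat, m%:R < 2 `^ (y ^+ 40) -> (m * N.+1 < 2 ^ r)%N].
Proof.
move=> y30 Ny.
have y1 : 1 <= y by lra.
have y0 : 0 <= y by lra.
have e1 n : 1 <= y ^+ n by apply: exprn_ege1.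
have tr x : 0 <= x -> (Num.truncn x)%:R <= x < (Num.truncn x)%:R + 1.
  by move/truncn_itv; rewrite -natr1.
have /andP[r1 r2] := tr _ (le_trans ler01 (e1 44%N)).
have /andP[k1 k2] := tr _ (le_trans ler01 (e1 99%N)).
exists (Num.truncn (y ^+ 44)), (Num.truncn (y ^+ 99)).+1.
set r := Num.truncn _ in r1 r2 *; set k := Num.truncn _ in k1 k2 *.
have y2 : 900 <= y ^+ 2 by rewrite expr2; nra.
have y40 : 900 * y <= y ^+ 40.
  have -> : y ^+ 40 = y ^+ 2 * (y * y ^+ 37) by rewrite -!exprS -exprD.
  by apply: ler_pM => //; rewrite ler_peMr.
(* Room in the exponent for $2^{y^{40}}$ times $2y^{440}$, the latter being at most
   $2^{1+440(y+1)}$. *)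
have r3 : y ^+ 40 + 441 + 440 * (y + 1) <= r%:R.
  have : 900 * y ^+ 40 <= y ^+ 44.
    rewrite (_ : 44%N = (2 + 2 + 40)%N) // exprD ler_wpM2r ?exprn_ge0 // exprD.
    by rewrite -[leLHS]mulr1 ler_pM // e1.
  by lra.
split=> //.
- by rewrite -(ltr_nat R); have := e1 40%N; lra.
- by rewrite -natr1; lra.
- rewrite -(ler_nat R) Ny natrM natrM natrX -(natr1 k).
  have k3 : (k%:R + 1) ^+ 2 <= (2 * y ^+ 99) ^+ 2.
    by rewrite lerXn2r ?nnegrE ?addr_ge0 ?mulr_ge0 ?ler0n ?exprn_ge0 //; have := e1 99%N; lra.
  apply: (@le_trans _ _ (128 * (2 * y ^+ 99) ^+ 2 * y ^+ 44)).
    apply: ler_pM => //; first by apply: mulr_ge0; rewrite ?sqr_ge0 // ler0n.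
    by rewrite ler_wpM2l ?ler0n.
  (* The constant $128 \cdot 4$ is absorbed by $y^2 \ge 900$. *)
  have -> : y ^+ 440 = y ^+ 2 * y ^+ 196 * (y ^+ 99) ^+ 2 * y ^+ 44.
    by rewrite -exprM -!exprD.
  rewrite ler_wpM2r ?exprn_ge0 // exprMn mulrA ler_wpM2r ?exprn_ge0 //.
  by have := e1 196%N; nra.
move=> m hm; rewrite -(ltr_nat R) natrX natrM -natr1 Ny -(@powR_mulrn _ 2) ?ler0n //.
apply: (@lt_le_trans _ _ (2 `^ (y ^+ 40) * (2 * y ^+ 440))).
  apply: (@le_lt_trans _ _ (m%:R * (2 * y ^+ 440))).
    rewrite ler_wpM2l ?ler0n //; have := e1 440%N; lra.
  by rewrite ltr_pM2r //; have := e1 440%N; lra.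
apply: (@le_trans _ _ (2 `^ (y ^+ 40) * 2 `^ (1 + 440 * (y + 1)))).
  rewrite ler_wpM2l ?powR_ge0 // powRD; last by rewrite pnatr_eq0 implybT.
  rewrite powRr1 ?ler0n // ler_wpM2l ?ler0n //.
  rewrite mulrC powRrM powR_mulrn ?powR_ge0 //.
  by rewrite lerXn2r ?nnegrE ?powR_ge0 // le_pow2D1.
rewrite -powRD; last by rewrite pnatr_eq0 implybT.
by apply: ler_powR; [rewrite ler1n|lra].
Qed.

End Asymptotics.

Theorem theorem4 (R : realType) (F : fieldType) (alpha : R)
    (halpha : 1 / 10 < alpha)
    (c1 c2 : R) (hc1 : 0 < c1) (hc2 : 0 < c2) (C : nat) :
  exists N0 : nat, forall N : nat, (N0 <= N)%N -> ~~ odd N ->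
  forall (m : nat) (f : 'I_m -> {mpoly (ratW F N)[N]}),
    (forall i : 'I_m, exists (d : nat) (P : abp {mpoly (ratW F N)[N]} d),
       [/\ alpha_sparse_roabp alpha c1 c2 C P,
           abp_eval P = f i
         & (abp_size P)%:R < 2 `^ (N%:R `^ (9 / 40) / log2 N%:R) :> R]) ->
    ry_poly F N = \sum_(i < m) f i ->
    2 `^ (N%:R `^ (1 / 11)) <= m%:R :> R.
Proof.
(* [A] ensures $N^{1/440} \ge 30$, and [B] ensures $c_1 N^{\alpha-1/10} \ge 1$. *)
pose A : R := 30 `^ 440%:R; pose B : R := c1^-1 `^ (alpha - 1 / 10)^-1.
exists (Num.truncn (A + B)).+1 => N leN evN m f hf eg.
have A0 : 0 <= A := powR_ge0 _ _; have B0 : 0 <= B := powR_ge0 _ _.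
have ABN : A + B <= N%:R.
  by apply: le_trans (ltW (truncnS_gt _)) _; rewrite ler_nat.
have root (x e : R) : 0 <= x -> 0 < e -> (x `^ e^-1) `^ e = x.
  by move=> x0 e0; rewrite -powRrM mulVf ?gt_eqF // powRr1.
have root' (x e : R) : 0 <= x -> 0 < e -> (x `^ e) `^ e^-1 = x.
  by move=> x0 e0; rewrite -powRrM mulfV ?gt_eqF // powRr1.
pose y : R := N%:R `^ (440%:R)^-1.
have y30 : 30 <= y.
  rewrite -(root' 30 440%:R) ?ltr0n ?ler0n //.
  apply: ge0_ler_powR; rewrite ?nnegrE ?invr_ge0 ?ler0n ?powR_ge0 //.
  by apply: le_trans ABN; rewrite lerDl.
have y0 : 0 <= y by apply: le_trans y30; rewrite ler0n.
have Ny : N%:R = y ^+ 440 by rewrite -powR_mulrn // root ?ler0n ?ltr0n.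
have powN n (e : R) : n%:R = 440%:R * e -> N%:R `^ e = y ^+ n.
  by move=> en; rewrite -powR_mulrn // -powRrM en mulKf // pnatr_eq0.
have p11 : N%:R `^ (1 / 11) = y ^+ 40 by apply: powN; lra.
have p10 : N%:R `^ (1 / 10) = y ^+ 44 by apply: powN; lra.
have p940 : N%:R `^ (9 / 40) = y ^+ 99 by apply: powN; lra.
have N2 : 2 <= N%:R :> R.
  by rewrite Ny; apply: le_trans (ler_eXnr _ _); rewrite //; lra.
have [r [k [r0 r44 k99 le_krN lt_m]]] := exists_parameters y30 Ny.
rewrite leNgt; apply/negP; rewrite p11 => hm.
have le_yk : y ^+ 40 <= k%:R.
  by apply: le_trans k99; rewrite ler_weXn2l //; lra.
apply: (@no_small_roabp_sum F N N./2 r k m f) eg => //.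
- by rewrite -[LHS]odd_double_half (negbTE evN).
- by rewrite -(ltr_nat R); apply: lt_le_trans k99; rewrite exprn_gt0 //; lra.
- exact: lt_m.
- exact/ltnW/(ltn_pow2_of_lt_powR hm le_yk).
move=> i; have [d [P [[d1 _ [t _ sP]] eP sz]]] := hf i.
exists d, t, P; split=> //.
(* Here $\alpha > 1/10$ enters: $d \ge c_1 N^\alpha \ge N^{1/10} \ge r$. *)
- rewrite -(ler_nat R); apply: le_trans r44 _; apply: le_trans d1; rewrite -p10.
  have -> : alpha = (alpha - 1 / 10) + 1 / 10 by lra.
  rewrite powRD; last by apply/implyP => _; apply: lt0r_neq0; lra.
  rewrite mulrA -[X in X <= _]mul1r ler_wpM2r ?powR_ge0 //.
  rewrite mulrC -ler_pdivrMr // [leLHS]mul1r.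
  rewrite -(root c1^-1 (alpha - 1 / 10)) ?invr_ge0 ?(ltW hc1) ?subr_gt0 //.
  apply: ge0_ler_powR; rewrite ?nnegrE ?ler0n ?powR_ge0 ?subr_ge0 ?(ltW halpha) //.
  by apply: le_trans ABN; rewrite lerDr.
(* As $\log_2 N \ge 1$, the exponent of the size bound is at most $N^{9/40} \le k$. *)
apply: (ltn_pow2_of_lt_powR sz); rewrite p940; apply: le_trans k99.
have l1 := log2_ge1 N2.
rewrite ler_pdivrMr; last by lra.
by rewrite ler_peMr // exprn_ge0.
Qed.
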